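(* Let $A\in\mathbb{R}^{n\times n}$, let $\mathcal{U}_0=\langle 0,G_0\rangle_Z\subset\mathbb{R}^n$ be a zonotope centered at the origin, let $0=t_0<t_1<t_2<\dots$ with $\Delta t_k=t_{k+1}-t_k$, and let $\eta_k$ be positive integers. The Hausdorff distance between the exact particular solution $$\mathcal{P}^{\mathcal{U}}(t_{k+1})=\Big\{\int_0^{t_{k+1}}e^{A(t_{k+1}-\theta)}u(\theta)\,\mathrm{d}\theta\ \Big|\ u(\theta)\in\mathcal{U}_0\Big\}$$ and the recursively computed outer-approximation $$\widehat{\mathcal{P}}^{\mathcal{U}}(t_{k+1})=\widehat{\mathcal{P}}^{\mathcal{U}}(t_k)\oplus e^{At_k}\widehat{\mathcal{P}}^{\mathcal{U}}(\Delta t_k),\qquad\widehat{\mathcal{P}}^{\mathcal{U}}(t_0)=\{0\},$$ with $$\widehat{\mathcal{P}}^{\mathcal{U}}(\Delta t_k)=\bigoplus_{i=0}^{\eta_k}\frac{A^i\Delta t_k^{i+1}}{(i+1)!}\,\mathcal{U}_0\oplus\boldsymbol{\mathcal{E}}(\Delta t_k,\eta_k)\Delta t_k\,\mathcal{U}_0,$$ is bounded by $$\varepsilon^{\mathcal{U}}_{k+1}=\varepsilon^{\mathcal{U}}_k+\Delta\varepsilon^{\mathcal{U}}_k(\Delta t_k,\eta_k),\qquad\varepsilon^{\mathcal{U}}_0=0,$$ where the error for one time step is bounded by $$\Delta\varepsilon^{\mathcal{U}}_k(\Delta t_k,\eta_k):=\operatorname{err}\Big(e^{At_k}\Big(\big(\textstyle\sum_{i=1}^{\eta_k}\tilde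 A_i\big)\mathcal{U}_0\oplus\boldsymbol{\mathcal{E}}(\Delta t_k,\eta_k)\Delta t_k\,\mathcal{U}_0\Big)\Big)+\operatorname{err}\Big(e^{At_k}\Big(\textstyle\bigoplus_{i=1}^{\eta_k}\tilde A_i\,\mathcal{U}_0\oplus\boldsymbol{\mathcal{E}}(\Delta t_k,\eta_k)\Delta t_k\,\mathcal{U}_0\Big)\Big)$$ with $\tilde A_i=\frac{A^i\Delta t_k^{i+1}}{(i+1)!}$.
   Context: A zonotope is $\langle c,G\rangle_Z=\{c+\sum_iG_{(\cdot,i)}\alpha_i:\alpha_i\in[-1,1]\}$. $\oplus$ is the Minkowski sum. Distances are Hausdorff distances with respect to the Euclidean norm. $\operatorname{box}(\mathcal{S})$ is the tightest axis-aligned box containing $\mathcal{S}$, $\operatorname{rad}(\mathcal{S})$ the radius of the smallest ball centered at the origin containing $\mathcal{S}$, and $\operatorname{err}(\mathcal{S}):=\operatorname{rad}(\operatorname{box}(\mathcal{S}))$. Input signals $u(\cdot)$ are (measurable) functions of time with $u(\theta)\in\mathcal{U}_0$ for all $\theta$. With $|A|$ the entrywise absolute value, $E(\Delta t,\eta)=e^{|A|\Delta t}-\sum_{i=0}^{\eta}\frac{(|A|\Delta t)^i}{i!}$ and $\boldsymbol{\mathcal{E}}(\Delta t,\eta)=[-E(\Delta t,\eta),E(\Delta t,\eta)]$ is the interval matrix of all $M$ with $-E\le M\le E$ entrywise. The product of $[-E,E]$ with a zonotope $\langle c,G\rangle_Z$ is evaluated by the outer-approximation $\langle0,\operatorname{diag}(E(|c|+\sum_j|G_{(\cdot,j)}|))\rangle_Z$.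 *)

(* Defs.v *)
From HB Require Import structures.
From mathcomp Require Import all_boot all_order all_algebra.
From mathcomp Require Import all_classical all_reals all_analysis.

Set Implicit Arguments.
Unset Strict Implicit.
Unset Printing Implicit Defensive.

Import Order.TTheory GRing.Theory Num.Theory.
Import numFieldNormedType.Exports.

Local Open Scope classical_set_scope.
Local Open Scope ring_scope.

(* The norm that the library puts on matrices is the max norm. *)
Definition enorm (R : realType) (n : nat) (x : 'cV[R]_n) : R :=
  Num.sqrt (\sum_(i < n) x i 0 ^+ 2).

(* Extended-real valued: it is [+oo], not a junk value, when a supremum is
   infinite. *)
Definition hausdorff_dist (R : realType) (n : nat) (X Y : set 'cV[R]_n) :
    \bar R :=
  Order.max
    (ereal_sup [set ereal_inf [set (enorm (x - y))%:E | y in Y] | x in X])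
    (ereal_sup [set ereal_inf [set (enorm (x - y))%:E | x in X] | y in Y]).

Definition minkowski_sum (R : realType) (n : nat) (X Y : set 'cV[R]_n) :
    set 'cV[R]_n :=
  [set x + y | x in X & y in Y].

Definition linear_map (R : realType) (m n : nat) (M : 'M[R]_(m, n))
    (X : set 'cV[R]_n) : set 'cV[R]_m :=
  [set M *m x | x in X].

Definition axis_box (R : realType) (n : nat) (lo hi : 'cV[R]_n) :
    set 'cV[R]_n :=
  [set x | forall i, lo i 0 <= x i 0 <= hi i 0].

(* The tightest box, as the intersection of all boxes containing [X]; it is the
   whole space when [X] is contained in none. *)
Definition box (R : realType) (n : nat) (X : set 'cV[R]_n) : set 'cV[R]_n :=
  \bigcap_(B in [set B | (exists lo hi, B = axis_box lo hi) /\ X `<=` B]) B.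

(* [+oo] when [X] is unbounded. *)
Definition origin_rad (R : realType) (n : nat) (X : set 'cV[R]_n) : \bar R :=
  ereal_inf [set r%:E | r in [set r | 0 <= r /\
                                      forall x, X x -> enorm x <= r]].

Definition err (R : realType) (n : nat) (X : set 'cV[R]_n) : \bar R :=
  origin_rad (box X).

Definition zonotope (R : realType) (n p : nat) (c : 'cV[R]_n)
    (G : 'M[R]_(n, p)) : set 'cV[R]_n :=
  [set c + G *m a | a in [set a : 'cV[R]_p | forall i, -1 <= a i 0 <= 1]].

Definition absmx (R : realType) (m n : nat) (A : 'M[R]_(m, n)) : 'M[R]_(m, n) :=
  map_mx Num.norm A.

Definition expmx (R : realType) (n : nat) (A : 'M[R]_n) : 'M[R]_n :=
  limn (series (fun k : nat => (k`!%:R)^-1 *: A ^+ k)).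

Definition exp_remainder (R : realType) (n : nat) (A : 'M[R]_n) (dt : R)
    (eta : nat) : 'M[R]_n :=
  expmx (dt *: absmx A)
  - \sum_(0 <= i < eta.+1) (i`!%:R)^-1 *: (dt *: absmx A) ^+ i.

(* The interval matrix [-E, E]; it is empty if [E] has a negative entry. *)
Definition symm_interval_mx (R : realType) (m n : nat) (E : 'M[R]_(m, n)) :
    set 'M[R]_(m, n) :=
  [set M | forall i j, - E i j <= M i j <= E i j].

(* The product of the interval matrix [-E, E] with <c, G>, which is by convention
   this zonotope and not the set of all products M *m z (a subset of it, see
   [symm_interval_mul_sub]).  It depends on the generators, not only on the set
   <c, G>, and is therefore a function of E, c and G. *)
Definition symm_interval_mul (R : realType) (m n p : nat) (E : 'M[R]_(m, n))
    (c : 'cV[R]_n) (G : 'M[R]_(n, p)) : set 'cV[R]_m :=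
  zonotope 0
    (diag_mx (E *m (absmx c + \sum_(j < p) absmx (col j G)))^T).

Lemma symm_interval_mul_sub (R : realType) (m n p : nat) (E : 'M[R]_(m, n))
    (c : 'cV[R]_n) (G : 'M[R]_(n, p)) (M : 'M[R]_(m, n)) (z : 'cV[R]_n) :
  symm_interval_mx E M -> zonotope c G z -> symm_interval_mul E c G (M *m z).
Proof.
move=> ME [a a1 <-]; set z' := c + G *m a.
set r := E *m (absmx c + \sum_(j < p) absmx (col j G)).
have zle k : `|z' k 0| <= (absmx c + \sum_(j < p) absmx (col j G)) k 0.
  rewrite !mxE (le_trans (ler_normD _ _))// lerD// summxE.
  rewrite (le_trans (ler_norm_sum _ _ _))// ler_sum// => j _.
  by rewrite !mxE normrM ler_piMr// ler_norml.
have Mzle i : `|(M *m z') i 0| <= r i 0.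
  rewrite !mxE (le_trans (ler_norm_sum _ _ _))// ler_sum// => k _.
  by rewrite normrM ler_pM// ler_norml.
rewrite /symm_interval_mul -/r; move: (M *m z') r Mzle => w r wle.
exists (\col_i (w i 0 / r i 0)) => [i|].
  rewrite mxE -ler_norml normrM normfV.
  have ri := le_trans (normr_ge0 _) (wle i).
  rewrite (ger0_norm ri); move: ri; rewrite le_eqVlt => /predU1P[<-|ri].
    by rewrite invr0 mulr0.
  by rewrite ler_pdivrMr// mul1r.
rewrite add0r; apply/colP => i; rewrite mul_diag_mx !mxE.
have := wle i; have [->|r0 _] := eqVneq (r i 0) 0.
  by rewrite normr_le0 mul0r => /eqP ->.
by rewrite mulrC divfK.
Qed.

(* Measurability of a signal is componentwise, and Borel. *)
Definition input_signal (R : realType) (n : nat) (U : set 'cV[R]_n)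
    (u : R -> 'cV[R]_n) : Prop :=
  (forall i, measurable_fun [set: R] (fun s => u s i 0)) /\ (forall s, U (u s)).

Definition particular_solution (R : realType) (n : nat) (A : 'M[R]_n)
    (U : set 'cV[R]_n) (t : R) : set 'cV[R]_n :=
  [set \col_i \int[lebesgue_measure]_(s in `[0, t])
                 (expmx ((t - s) *: A) *m u s) i 0
  | u in input_signal U].

(* The matrix tilde A_i = A^i dt^(i+1) / (i+1)! *)
Definition Atilde (R : realType) (n : nat) (A : 'M[R]_n) (dt : R) (i : nat) :
    'M[R]_n :=
  (dt ^+ i.+1 / (i.+1)`!%:R) *: A ^+ i.

(* The term [-E(dt, eta), E(dt, eta)] dt U0 with U0 = <0, G0>. *)
Definition remainder_set (R : realType) (n p : nat) (A : 'M[R]_n)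
    (G0 : 'M[R]_(n, p)) (dt : R) (eta : nat) : set 'cV[R]_n :=
  symm_interval_mul (dt *: exp_remainder A dt eta) 0 G0.

Definition particular_step (R : realType) (n p : nat) (A : 'M[R]_n)
    (G0 : 'M[R]_(n, p)) (dt : R) (eta : nat) : set 'cV[R]_n :=
  minkowski_sum
    (\big[@minkowski_sum R n/[set 0]]_(0 <= i < eta.+1)
       linear_map (Atilde A dt i) (zonotope 0 G0))
    (remainder_set A G0 dt eta).

Fixpoint particular_approx (R : realType) (n p : nat) (A : 'M[R]_n)
    (G0 : 'M[R]_(n, p)) (t : nat -> R) (eta : nat -> nat) (k : nat) :
    set 'cV[R]_n :=
  if k is l.+1 then
    minkowski_sum (particular_approx A G0 t eta l)
      (linear_map (expmx (t l *: A))
         (particular_step A G0 (t l.+1 - t l) (eta l)))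
  else [set 0].

(* One-step error bound, for a step of length [dt] starting at time [tk]. *)
Definition step_error_bound (R : realType) (n p : nat) (A : 'M[R]_n)
    (G0 : 'M[R]_(n, p)) (tk dt : R) (eta : nat) : \bar R :=
  (err (linear_map (expmx (tk *: A))
     (minkowski_sum
        (linear_map (\sum_(1 <= i < eta.+1) Atilde A dt i) (zonotope 0 G0))
        (remainder_set A G0 dt eta)))%R
  + err (linear_map (expmx (tk *: A))
     (minkowski_sum
        (\big[@minkowski_sum R n/[set 0]]_(1 <= i < eta.+1)
           linear_map (Atilde A dt i) (zonotope 0 G0))
        (remainder_set A G0 dt eta)))%R)%E.

Fixpoint error_bound (R : realType) (n p : nat) (A : 'M[R]_n)
    (G0 : 'M[R]_(n, p)) (t : nat -> R) (eta : nat -> nat) (k : nat) : \bar R :=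
  if k is l.+1 then
    (error_bound A G0 t eta l
     + step_error_bound A G0 (t l) (t l.+1 - t l) (eta l))%E
  else 0%E.

(* Main.v *)
Require Import Defs.
From mathcomp Require Import all_boot all_order all_algebra.
From mathcomp Require Import all_classical all_reals all_analysis.
From mathcomp Require Import measurable_realfun ring lra.

Set Implicit Arguments.
Unset Strict Implicit.
Unset Printing Implicit Defensive.

Import Order.TTheory GRing.Theory Num.Theory.
Import numFieldNormedType.Exports.

Local Open Scope classical_set_scope.
Local Open Scope ring_scope.

(** Write [Z] for the input zonotope and split the exponential series under the
    integral [\int_0^d e^(A(d-s)) u(s) ds] after order [eta].  The term of order
    [k] is [A^k] applied to a weighted integral of the signal, and since [Z] is
    compact and convex the corresponding weighted mean is a point of [Z]
    ([zonotope_weighted_mean]).  The rest is bounded entry by entry by the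
    remainder of the exponential of [absmx A], so it lies in the remainder set
    ([remainder_set_vintegral]).  Hence the exact solution over one step is
    contained in its outer approximation ([particular_solution_sub_step]), and
    only the distance from the approximation to the exact set costs anything.

    For that direction a point [Atilde_0 v + y1 + e] of the approximation is
    compared with the response to the constant signal [v], which is
    [Atilde_0 v + (sum of the Atilde_i, i >= 1) v + e'] with [e'] in the remainder
    set.  The terms of order zero cancel, and what remains is a point of the
    first set of the step bound minus a point of the second one; each is at most
    as long as the radius of the box around its set ([particular_step_near]).

    Over several steps, the solution sets concatenate:
    [P(a + b) = P(a) + e^(Aa) P(b)] ([particular_solutionD]), because signals can be
    cut and glued, the Lebesgue measure is invariant under translation, and the
    matrix exponential is multiplicative along a line ([expmxD]).  The
    approximation obeys the same recursion by definition, so inclusions and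
    errors add up by induction and the triangle inequality. *)

(** * Euclidean norm, Hausdorff distance and box radius *)

Lemma cauchy_schwarz (R : realType) (n : nat) (a b : 'I_n -> R) :
  \sum_i a i * b i <=
  Num.sqrt (\sum_i a i ^+ 2) * Num.sqrt (\sum_i b i ^+ 2).
Proof.
set SA := \sum_i a i ^+ 2; set SB := \sum_i b i ^+ 2.
have SA0 : 0 <= SA by apply: sumr_ge0 => i _; exact: sqr_ge0.
have SB0 : 0 <= SB by apply: sumr_ge0 => i _; exact: sqr_ge0.
(* The weighted form of 2ab <= a^2 + b^2; taking the two norms as weights gives
   the claim when both are nonzero. *)
have key (x y : R) :
    (x * y) * (\sum_i a i * b i) *+ 2 <= y ^+ 2 * SA + x ^+ 2 * SB.
  rewrite !mulr_sumr -sumrMnl -big_split/=; apply: ler_sum => i _.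
  by have := sqr_ge0 (y * a i - x * b i); nra.
have [p0|p0] := eqVneq (Num.sqrt SA * Num.sqrt SB) 0.
  rewrite p0 leNgt; apply/negP => S0.
  move/eqP: p0; rewrite mulf_eq0 !sqrtr_eq0 => /orP[s|s].
    have /eqP SAE : SA == 0 by rewrite eq_le s.
    have := key (\sum_i a i * b i) (SB + 1).
    rewrite SAE mulr0 add0r => h2; nra.
  have /eqP SBE : SB == 0 by rewrite eq_le s.
  have := key (SA + 1) (\sum_i a i * b i).
  rewrite SBE mulr0 addr0 => h2; nra.
have := key (Num.sqrt SA) (Num.sqrt SB).
rewrite !sqr_sqrtr// => h.
have p1 : 0 < Num.sqrt SA * Num.sqrt SB.
  by rewrite lt_def p0/= mulr_ge0// sqrtr_ge0.
rewrite -(ler_pM2l p1).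
have -> : Num.sqrt SA * Num.sqrt SB * (Num.sqrt SA * Num.sqrt SB) = SA * SB.
  by rewrite mulrACA -!expr2 !sqr_sqrtr.
by nra.
Qed.

Lemma enorm_ge0 (R : realType) (n : nat) (x : 'cV[R]_n) : 0 <= enorm x.
Proof. exact: sqrtr_ge0. Qed.

Lemma enorm0 (R : realType) (n : nat) : enorm (0 : 'cV[R]_n) = 0.
Proof.
by rewrite /enorm big1 ?sqrtr0// => i _; rewrite mxE expr0n.
Qed.

Lemma enormN (R : realType) (n : nat) (x : 'cV[R]_n) : enorm (- x) = enorm x.
Proof.
by congr Num.sqrt; apply: eq_bigr => i _; rewrite mxE sqrrN.
Qed.

Lemma enormD (R : realType) (n : nat) (x y : 'cV[R]_n) :
  enorm (x + y) <= enorm x + enorm y.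
Proof.
have sq (z : 'cV[R]_n) : enorm z ^+ 2 = \sum_i z i 0 ^+ 2.
  by rewrite sqr_sqrtr//; apply: sumr_ge0 => i _; exact: sqr_ge0.
rewrite -(@ler_pXn2r _ 2)// ?nnegrE ?addr_ge0 ?enorm_ge0//.
rewrite sqrrD !sq.
have := cauchy_schwarz (fun i => x i 0) (fun i => y i 0).
rewrite -/(enorm x) -/(enorm y) => xy.
under eq_bigr do rewrite mxE sqrrD.
by rewrite !big_split/= -mulr2n lerD2r lerD2l lerMn2r.
Qed.

Lemma hausdorff_dist_le (R : realType) (n : nat) (X Y : set 'cV[R]_n)
    (e : \bar R) :
  (forall x, X x -> exists2 y, Y y & ((enorm (x - y))%:E <= e)%E) ->
  (forall y, Y y -> exists2 x, X x & ((enorm (x - y))%:E <= e)%E) ->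
  (hausdorff_dist X Y <= e)%E.
Proof.
move=> XY YX; rewrite /hausdorff_dist ge_max; apply/andP; split.
  apply/ereal_supP => _ [x Xx <-]; have [y Yy xy] := XY x Xx.
  by apply: le_trans xy; apply: ereal_inf_lbound; exists y.
apply/ereal_supP => _ [y Yy <-]; have [x Xx xy] := YX y Yy.
by apply: le_trans xy; apply: ereal_inf_lbound; exists x.
Qed.

Lemma err_ge0 (R : realType) (n : nat) (X : set 'cV[R]_n) : (0 <= err X)%E.
Proof. by apply/ereal_infP => _ [r [r0 _] <-]; rewrite lee_fin. Qed.

(** The box of [X] contains [X], so its radius bounds the points of [X]. *)
Lemma enorm_le_err (R : realType) (n : nat) (X : set 'cV[R]_n) (x : 'cV[R]_n) :
  X x -> ((enorm x)%:E <= err X)%E.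
Proof.
move=> Xx; apply/ereal_infP => _ [r [_ Xr] <-]; rewrite lee_fin.
by apply: Xr => B [_ XB]; exact: XB.
Qed.

Lemma enormB_le_err (R : realType) (n : nat) (X Y : set 'cV[R]_n)
    (x y : 'cV[R]_n) :
  X x -> Y y -> ((enorm (x - y))%:E <= err X + err Y)%E.
Proof.
move=> Xx Yy; apply: (@le_trans _ _ (enorm x + enorm y)%:E).
  by rewrite lee_fin -[enorm y]enormN enormD.
by rewrite EFinD leeD// enorm_le_err.
Qed.

(** * The matrix exponential *)

Lemma scalemx_expr (R : realType) (n : nat) (A : 'M[R]_n) (s : R) (k : nat) :
  (s *: A) ^+ k = s ^+ k *: A ^+ k.
Proof.
elim: k => [|k IH]; first by rewrite !expr0 scale1r.
by rewrite !exprS IH -!mulmxE -scalemxAl -scalemxAr scalerA.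
Qed.

Lemma absmx_expr_ge (R : realType) (n : nat) (A : 'M[R]_n) (k : nat) i j :
  `|(A ^+ k) i j| <= (absmx A ^+ k) i j.
Proof.
elim: k i j => [|k IH] i j.
  by rewrite !expr0 !mxE; case: (i == j); rewrite ?mulr1n ?mulr0n ?normr1 ?normr0.
rewrite !exprS -!mulmxE !mxE; apply: le_trans (ler_norm_sum _ _ _) _.
by apply: ler_sum => l _; rewrite normrM mxE ler_wpM2l.
Qed.

Definition entry_sum (R : realType) (n : nat) (A : 'M[R]_n) : R :=
  \sum_i \sum_j `|A i j|.

Lemma entry_sum_ge0 (R : realType) (n : nat) (A : 'M[R]_n) : 0 <= entry_sum A.
Proof. by apply: sumr_ge0 => i _; apply: sumr_ge0. Qed.

(** Every row sum of [absmx A] is at most [entry_sum A], so each factor [absmx A]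
    of the power costs at most one factor [entry_sum A].  This compares the matrix
    exponential series with a scalar one. *)
Lemma absmx_expr_le (R : realType) (n : nat) (A : 'M[R]_n) (k : nat) i j :
  (absmx A ^+ k) i j <= entry_sum A ^+ k.
Proof.
elim: k i j => [|k IH] i j.
  by rewrite !expr0 mxE; case: (i == j); rewrite ?mulr1n ?mulr0n.
rewrite !exprS -!mulmxE !mxE.
apply: (@le_trans _ _ (\sum_l `|A i l| * entry_sum A ^+ k)).
  by apply: ler_sum => l _; rewrite mxE ler_wpM2l.
rewrite -mulr_suml ler_wpM2r ?exprn_ge0 ?entry_sum_ge0//.
rewrite /entry_sum [leRHS](bigD1 i)//= lerDl.
by apply: sumr_ge0 => ? _; apply: sumr_ge0.
Qed.

Lemma expmx_coef_le (R : realType) (n : nat) (A : 'M[R]_n) (k : nat) i j :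
  `|(k`!%:R)^-1 * (A ^+ k) i j| <= exp_coeff (entry_sum A) k.
Proof.
rewrite normrM ger0_norm ?invr_ge0// mulrC ler_wpM2r ?invr_ge0//.
exact: le_trans (absmx_expr_ge _ _ _ _) (absmx_expr_le _ _ _ _).
Qed.

Lemma cvg_mx_entries (R : realType) (m n : nat) (u : nat -> 'M[R]_(m, n))
    (L : 'M[R]_(m, n)) :
  (forall i j, u N i j @[N --> \oo] --> L i j) -> u @ \oo --> L.
Proof.
move=> uL; apply/cvg_mx_entourageP => B entB.
apply: filter_forall => i; apply: filter_forall => j.
have /cvg_entourageP /(_ _ entB) := uL i j.
by rewrite !near_simpl; apply: filterS => N BN; rewrite inE.
Qed.

(** The exponential series converges entrywise because it is dominated by the
    scalar one at [entry_sum A]. *)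
Lemma expmx_cvg (R : realType) (n : nat) (A : 'M[R]_n) i j :
  \sum_(0 <= k < N) (k`!%:R)^-1 * (A ^+ k) i j @[N --> \oo] --> expmx A i j.
Proof.
pose c i j k : R := (k`!%:R)^-1 * (A ^+ k) i j.
have cvgc a b : cvgn (series (c a b)).
  apply: normed_cvg; apply: series_le_cvg (is_cvg_series_exp_coeff (entry_sum A)).
  - by move=> k; exact: normr_ge0.
  - by move=> k; apply: exp_coeff_ge0; exact: entry_sum_ge0.
  - by move=> k; exact: expmx_coef_le.
pose L := \matrix_(a, b) limn (series (c a b)).
have uL : series (fun k : nat => (k`!%:R)^-1 *: A ^+ k) @ \oo --> L.
  apply: cvg_mx_entries => a b; rewrite mxE.
  rewrite [X in X @ \oo --> _](_ : _ = series (c a b)); first exact: cvgc.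
  by apply/funext => N; rewrite /series/= summxE; apply: eq_bigr => k _; rewrite mxE.
have -> : expmx A = L by apply/cvg_lim.
by rewrite mxE; exact: cvgc.
Qed.

Lemma expmxZ_cvg (R : realType) (n : nat) (A : 'M[R]_n) (s : R) i j :
  \sum_(0 <= k < N) exp_coeff s k * (A ^+ k) i j @[N --> \oo]
    --> expmx (s *: A) i j.
Proof.
rewrite [X in X @ _ --> _](_ : _ =
    fun N => \sum_(0 <= k < N) (k`!%:R)^-1 * ((s *: A) ^+ k) i j).
  exact: expmx_cvg.
apply/funext => N; apply: eq_bigr => k _.
by rewrite scalemx_expr mxE mulrA [_^-1 * _]mulrC.
Qed.

(** The remainder of the exponential series at time [s].  From order zero it is
    the exponential itself, so that one set of bounds serves for both. *)
Definition exp_tail (R : realType) (n : nat) (A : 'M[R]_n) (s : R) (m : nat) :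
    'M[R]_n :=
  expmx (s *: A) - \sum_(0 <= k < m) exp_coeff s k *: A ^+ k.

Lemma exp_remainderE (R : realType) (n : nat) (A : 'M[R]_n) (d : R)
    (eta : nat) :
  exp_remainder A d eta = exp_tail (absmx A) d eta.+1.
Proof.
congr (_ - _); apply: eq_bigr => k _.
by rewrite scalemx_expr scalerA mulrC.
Qed.

Lemma exp_tail_cvg (R : realType) (n : nat) (A : 'M[R]_n) (s : R) (m : nat)
    i j :
  \sum_(m <= k < N) exp_coeff s k * (A ^+ k) i j @[N --> \oo]
    --> exp_tail A s m i j.
Proof.
rewrite [exp_tail _ _ _ _ _]mxE [X in _ + X]mxE.
set S := (\sum_(0 <= k < m) exp_coeff s k *: A ^+ k) i j.
have SE : S = \sum_(0 <= k < m) exp_coeff s k * (A ^+ k) i j.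
  by rewrite /S summxE; apply: eq_bigr => k _; rewrite mxE.
apply: (cvg_trans _ (cvgB (@expmxZ_cvg _ _ A s i j) (cvg_cst S))).
apply: near_eq_cvg; near=> N.
have mN : (m <= N)%N by near: N; exact: nbhs_infty_ge.
rewrite /= ?fctE SE; apply/eqP; rewrite subr_eq addrC; apply/eqP.
by rewrite -big_cat_nat.
Unshelve. all: by end_near. Qed.

(** Term by term, [A ^+ k] is dominated by [absmx A ^+ k], and the scalar
    coefficients grow with the absolute value of the time. *)
Lemma exp_tail_le (R : realType) (n : nat) (A : 'M[R]_n) (s d : R) (m : nat)
    i j :
  `|s| <= d -> `|exp_tail A s m i j| <= exp_tail (absmx A) d m i j.
Proof.
move=> sd; have := @exp_tail_cvg _ _ A s m i j => /cvg_norm cA.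
apply: ler_cvg_to cA (@exp_tail_cvg _ _ (absmx A) d m i j) _.
apply: nearW => N; apply: le_trans (ler_norm_sum _ _ _) _.
apply: ler_sum => k _; rewrite normrM /exp_coeff/= normrM normrX.
rewrite [`|_^-1|]ger0_norm ?invr_ge0//; apply: ler_pM => //.
- by rewrite ler_wpM2r ?invr_ge0// lerXn2r ?nnegrE ?(le_trans _ sd).
- exact: absmx_expr_ge.
Qed.

Lemma exp_tail0 (R : realType) (n : nat) (A : 'M[R]_n) (s : R) :
  exp_tail A s 0 = expmx (s *: A).
Proof. by rewrite /exp_tail big_geq// subr0. Qed.

(** Finite form of the Cauchy product: what separates a product of two partial
    sums from the partial sum of the product is the triangle of the terms beyond
    the antidiagonal. *)
Lemma sum_square_triangle (V : zmodType) (F : nat -> nat -> V) (N : nat) :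
  \sum_(0 <= p < N) \sum_(0 <= q < N) F p q =
  \sum_(0 <= k < N) \sum_(0 <= p < k.+1) F p (k - p)%N +
  \sum_(0 <= p < N) \sum_(0 <= q < N | (N <= p + q)%N) F p q.
Proof.
have -> : \sum_(0 <= k < N) \sum_(0 <= p < k.+1) F p (k - p)%N =
    \sum_(0 <= p < N) \sum_(0 <= q < N | (p + q < N)%N) F p q.
  transitivity (\sum_(0 <= k < N) \sum_(0 <= p < N | (p <= k)%N) F p (k - p)%N).
    apply: eq_big_nat => k /andP[_ kN].
    by rewrite (big_nat_widen _ _ N)//=.
  rewrite (exchange_big_dep_nat predT)//=.
  apply: eq_big_nat => p /andP[_ pN].
  transitivity (\sum_(p <= k < N) F p (k - p)%N).
    by rewrite [RHS](big_nat_widenl _ 0%N).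
  rewrite -{1}(add0n p) big_addn.
  rewrite [RHS](_ : _ = \sum_(0 <= q < N | (q < N - p)%N) F p q); last first.
    by apply: eq_bigl => q; rewrite ltn_subRL.
  rewrite -(big_nat_widen _ _ _ xpredT) ?leq_subr//.
  by apply: eq_bigr => q _; rewrite addnK.
rewrite -big_split/=; apply: eq_bigr => p _.
rewrite (bigID (fun q => (p + q < N)%N))/=; congr (_ + _).
by apply: eq_bigl => q; rewrite -leqNgt.
Qed.

Lemma exp_coeffD (R : realType) (s t : R) (k : nat) :
  exp_coeff (s + t) k =
  \sum_(0 <= p < k.+1) exp_coeff s p * exp_coeff t (k - p)%N.
Proof.
rewrite big_mkord /exp_coeff/= addrC exprDn mulr_suml.
apply: eq_bigr => p _; have pk : (p <= k)%N by rewrite -ltnS.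
rewrite -mulr_natr -(bin_fact pk) !natrM.
have f0 q : q`!%:R != 0 :> R by rewrite pnatr_eq0 -lt0n fact_gt0.
have b0 : 'C(k, p)%:R != 0 :> R by rewrite pnatr_eq0 -lt0n bin_gt0.
by field; rewrite f0 f0 b0.
Qed.

(** The partial sums of the product and of the exponential of the sum differ by
    the upper triangle of the square of terms.  That triangle is dominated by
    the one of the scalar exponentials at [entry_sum A] times the times, which
    tends to zero by [expRD]. *)
Lemma expmxD (R : realType) (n : nat) (A : 'M[R]_n) (s t : R) :
  expmx ((s + t) *: A) = expmx (s *: A) *m expmx (t *: A).
Proof.
apply/matrixP => i j.
have [c cE] : exists c, c = entry_sum A by eexists.
pose U x N := \sum_(0 <= k < N) exp_coeff x k *: A ^+ k.
have UE x N a b : U x N a b = \sum_(0 <= k < N) exp_coeff x k * (A ^+ k) a b.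
  by rewrite /U summxE; apply: eq_bigr => k _; rewrite mxE.
have Ucvg x a b : U x N a b @[N --> \oo] --> expmx (x *: A) a b.
  by under eq_fun do rewrite UE; exact: expmxZ_cvg.
pose D N := (U s N *m U t N) i j - U (s + t) N i j.
have Dcvg : D @ \oo -->
    (expmx (s *: A) *m expmx (t *: A)) i j - expmx ((s + t) *: A) i j.
  apply: cvgB; last exact: Ucvg.
  rewrite mxE; under eq_fun do rewrite mxE.
  by apply: cvg_big => [|l _]; [exact: add_continuous|apply: cvgM]; exact: Ucvg.
pose e x N : R := series (exp_coeff x) N.
have ecvg x : e x @ \oo --> expR x by exact: is_cvg_series_exp_coeff.
pose d N := e (`|s| * c) N * e (`|t| * c) N - e (`|s| * c + `|t| * c) N.
have dcvg : d @ \oo --> (0 : R).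
  rewrite -(subrr (expR (`|s| * c + `|t| * c))) {1}expRD.
  by apply: cvgB => //; apply: cvgM.
have exp_coeffM x k : exp_coeff (`|x| * c) k = `|exp_coeff x k| * c ^+ k.
  by rewrite /exp_coeff/= exprMn normrM normrX [`|_^-1|]ger0_norm ?invr_ge0// mulrAC.
have dE N : d N = \sum_(0 <= p < N) \sum_(0 <= q < N | (N <= p + q)%N)
    exp_coeff (`|s| * c) p * exp_coeff (`|t| * c) q.
  rewrite /d /e /series/= mulr_suml.
  under [X in X - _]eq_bigr do rewrite mulr_sumr.
  rewrite (sum_square_triangle
    (fun p q => exp_coeff (`|s| * c) p * exp_coeff (`|t| * c) q)).
  under [X in _ - X]eq_bigr do rewrite exp_coeffD.
  by rewrite addrAC subrr add0r.
have DE N : D N = \sum_(0 <= p < N) \sum_(0 <= q < N | (N <= p + q)%N)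
    exp_coeff s p * exp_coeff t q * (A ^+ (p + q)) i j.
  rewrite /D; have -> : U s N *m U t N =
      \sum_(0 <= p < N) \sum_(0 <= q < N)
        (exp_coeff s p * exp_coeff t q) *: A ^+ (p + q).
    rewrite mulmx_suml; apply: eq_bigr => p _.
    rewrite mulmx_sumr; apply: eq_bigr => q _.
    by rewrite -scalemxAl -scalemxAr scalerA exprD -mulmxE.
  have -> : U (s + t) N = \sum_(0 <= k < N) \sum_(0 <= p < k.+1)
      (exp_coeff s p * exp_coeff t (k - p)%N) *: A ^+ (p + (k - p)).
    apply: eq_bigr => k _; rewrite exp_coeffD scaler_suml.
    by apply: eq_big_nat => p /andP[_ pk]; rewrite subnKC.
  rewrite (sum_square_triangle
    (fun p q => (exp_coeff s p * exp_coeff t q) *: A ^+ (p + q))).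
  rewrite mxE addrAC subrr add0r.
  rewrite !summxE; apply: eq_bigr => p _.
  by rewrite summxE; apply: eq_bigr => q _; rewrite mxE.
have Dd N : `|D N| <= d N.
  rewrite DE dE; apply: le_trans (ler_norm_sum _ _ _) _; apply: ler_sum => p _.
  apply: le_trans (ler_norm_sum _ _ _) _; apply: ler_sum => q _.
  rewrite !exp_coeffM [leRHS]mulrACA -exprD 2!normrM ler_wpM2l ?mulr_ge0//.
  rewrite cE.
  exact: le_trans (absmx_expr_ge _ _ _ _) (absmx_expr_le _ _ _ _).
apply/esym/eqP; rewrite -subr_eq0 -normr_le0.
exact: ler_cvg_to (cvg_norm Dcvg) dcvg (nearW _ Dd).
Qed.

(** The entries of the exponential are pointwise limits of polynomials. *)
Lemma measurable_exp_tail (R : realType) (n : nat) (A : 'M[R]_n) (m : nat)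
    (d : R) i j :
  measurable_fun [set: R] (fun s => exp_tail A (d - s) m i j).
Proof.
pose p N s := \sum_(m <= k < N) exp_coeff (d - s) k * (A ^+ k) i j.
have mp N : measurable_fun [set: R] (p N).
  apply: measurable_sum => k; apply: measurable_funM => //.
  apply: measurable_funM => //; apply: measurable_funX.
  exact: measurable_funB.
apply: (measurable_fun_cvg mp) => s _; exact: exp_tail_cvg.
Qed.

(** * Integrals of vector-valued functions *)

Definition vintegral (R : realType) (n : nat) (D : set R) (f : R -> 'cV[R]_n) :
    'cV[R]_n :=
  \col_i \int[lebesgue_measure]_(s in D) f s i 0.

Definition vintegrable (R : realType) (n : nat) (D : set R)
    (f : R -> 'cV[R]_n) : Prop :=
  forall i, lebesgue_measure.-integrable D (EFin \o (fun s => f s i 0)).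

Lemma integrable_bounded (R : realType) (a b C : R) (f : R -> R) :
  measurable_fun [set: R] f -> (forall s, a <= s <= b -> `|f s| <= C) ->
  lebesgue_measure.-integrable `[a, b] (EFin \o f).
Proof.
move=> mf fC; apply: measurable_bounded_integrable => //.
- by rewrite /= lebesgue_measure_itv; case: ifPn => // _; rewrite -EFinD ltry.
- exact: measurable_funTS.
- exists C; split; first exact: num_real.
  move=> M CM s /=; rewrite in_itv/= => sab.
  exact: le_trans (fC s sab) (ltW CM).
Qed.

Lemma integrable_sumR (R : realType) (D : set R) (I : Type) (r : seq I)
    (f : I -> R -> R) :
  measurable D ->
  (forall i, lebesgue_measure.-integrable D (EFin \o f i)) ->
  lebesgue_measure.-integrable D (EFin \o (fun s => \sum_(i <- r) f i s)).
Proof.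
move=> mD intf.
rewrite (_ : _ \o _ = fun s => (\sum_(i <- r) (EFin \o f i) s)%E).
  by apply: integrable_sum.
by apply/funext => s; rewrite /= sumEFin.
Qed.

Lemma Rintegral_sumR (R : realType) (D : set R) (I : Type) (r : seq I)
    (f : I -> R -> R) :
  measurable D ->
  (forall i, lebesgue_measure.-integrable D (EFin \o f i)) ->
  \int[lebesgue_measure]_(s in D) (\sum_(i <- r) f i s) =
  \sum_(i <- r) \int[lebesgue_measure]_(s in D) f i s.
Proof.
move=> mD intf; elim: r => [|i r IH].
  rewrite big_nil; under eq_Rintegral do rewrite big_nil.
  by rewrite Rintegral_cst// mul0r.
rewrite big_cons -IH; under eq_Rintegral do rewrite big_cons.
by rewrite RintegralD//; exact: integrable_sumR.
Qed.

Lemma eq_vintegral (R : realType) (n : nat) (D : set R)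
    (f g : R -> 'cV[R]_n) :
  (forall s, D s -> f s = g s) -> vintegral D f = vintegral D g.
Proof.
move=> fg; apply/colP => i; rewrite !mxE; apply: eq_Rintegral => s.
by rewrite inE => /fg ->.
Qed.

Lemma vintegralD (R : realType) (n : nat) (D : set R) (f g : R -> 'cV[R]_n) :
  measurable D -> vintegrable D f -> vintegrable D g ->
  vintegral D (fun s => f s + g s) = vintegral D f + vintegral D g.
Proof.
move=> mD intf intg; apply/colP => i; rewrite !mxE.
by under eq_Rintegral do rewrite mxE; rewrite RintegralD.
Qed.

Lemma vintegrable_sum (R : realType) (n : nat) (D : set R) (I : Type)
    (r : seq I) (f : I -> R -> 'cV[R]_n) :
  measurable D -> (forall i, vintegrable D (f i)) ->
  vintegrable D (fun s => \sum_(i <- r) f i s).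
Proof.
move=> mD intf i; rewrite [X in EFin \o X](_ : _ = fun s => \sum_(k <- r) f k s i 0).
  by apply: integrable_sumR => // k; exact: intf.
by apply/funext => s; rewrite summxE.
Qed.

Lemma vintegral_sum (R : realType) (n : nat) (D : set R) (I : Type)
    (r : seq I) (f : I -> R -> 'cV[R]_n) :
  measurable D -> (forall i, vintegrable D (f i)) ->
  vintegral D (fun s => \sum_(i <- r) f i s) =
  \sum_(i <- r) vintegral D (f i).
Proof.
move=> mD intf; apply/colP => i; rewrite summxE mxE.
under eq_Rintegral do rewrite summxE.
rewrite Rintegral_sumR//; last by move=> k; exact: intf.
by apply: eq_bigr => k _; rewrite mxE.
Qed.

Lemma integrable_mull (R : realType) (D : set R) (c : R) (f : R -> R) :
  measurable D -> lebesgue_measure.-integrable D (EFin \o f) ->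
  lebesgue_measure.-integrable D (EFin \o (fun s => c * f s)).
Proof.
move=> mD intf; rewrite (_ : _ \o _ = fun s => (c%:E * (EFin \o f) s)%E).
  exact: integrableZl.
by apply/funext => s; rewrite /= EFinM.
Qed.

Lemma vintegrable_mulmx (R : realType) (m n : nat) (D : set R)
    (M : 'M[R]_(m, n)) (f : R -> 'cV[R]_n) :
  measurable D -> vintegrable D f -> vintegrable D (fun s => M *m f s).
Proof.
move=> mD intf i.
rewrite [X in EFin \o X](_ : _ = fun s => \sum_j M i j * f s j 0).
  by apply: integrable_sumR => // j; apply: integrable_mull.
by apply/funext => s; rewrite mxE.
Qed.

Lemma vintegral_mulmx (R : realType) (m n : nat) (D : set R)
    (M : 'M[R]_(m, n)) (f : R -> 'cV[R]_n) :
  measurable D -> vintegrable D f ->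
  vintegral D (fun s => M *m f s) = M *m vintegral D f.
Proof.
move=> mD intf; apply/colP => i; rewrite !mxE.
under eq_Rintegral do rewrite mxE.
rewrite Rintegral_sumR//; last by move=> j; exact: integrable_mull.
by apply: eq_bigr => j _; rewrite mxE RintegralZl.
Qed.

Lemma vintegrable_mulmx_bounded (R : realType) (n : nat) (a b : R)
    (M : R -> 'M[R]_n) (f : R -> 'cV[R]_n) (B : 'M[R]_n) (C : 'cV[R]_n) :
  (forall i j, measurable_fun [set: R] (fun s => M s i j)) ->
  (forall i, measurable_fun [set: R] (fun s => f s i 0)) ->
  (forall s i j, a <= s <= b -> `|M s i j| <= B i j) ->
  (forall s i, `|f s i 0| <= C i 0) ->
  vintegrable `[a, b] (fun s => M s *m f s).
Proof.
move=> mM mf MB fC i; apply: (@integrable_bounded _ _ _ ((B *m C) i 0)).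
  under eq_fun do rewrite mxE.
  by apply: measurable_sum => j; apply: measurable_funM.
move=> s sab; rewrite !mxE; apply: le_trans (ler_norm_sum _ _ _) _.
by apply: ler_sum => j _; rewrite normrM ler_pM// MB.
Qed.

Lemma normr_Rintegral_le (R : realType) (a b C : R) (f : R -> R) :
  a <= b -> measurable_fun [set: R] f ->
  (forall s, a <= s <= b -> `|f s| <= C) ->
  `|\int[lebesgue_measure]_(s in `[a, b]) f s| <= (b - a) * C.
Proof.
move=> ab mf fC; have intf := integrable_bounded mf fC.
apply: le_trans (le_normr_Rintegral _ intf) _ => //.
have mN : measurable_fun [set: R] (fun s => `|f s|) by exact: measurableT_comp.
apply: (@le_trans _ _ (\int[lebesgue_measure]_(s in `[a, b]) cst C s)).
  apply: le_Rintegral => //.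
  - by apply: (integrable_bounded (C := C)) => // s sab; rewrite normr_id fC.
  - by apply: (integrable_bounded (C := `|C|)) => //; exact: measurable_cst.
rewrite Rintegral_cst//= lebesgue_measure_itv/= lte_fin.
have [_|ba] := ltrP a b; first by rewrite -EFinD/= mulrC.
by have -> : a = b by [apply/eqP; rewrite eq_le ab]; rewrite subrr mulr0 mul0r.
Qed.

(** The antiderivative of [s |-> (d - s) ^ k / k!] is the next term of the
    exponential series, up to sign. *)
Lemma Rintegral_exp_coeff (R : realType) (d : R) (k : nat) :
  0 < d ->
  \int[lebesgue_measure]_(s in `[0, d]) exp_coeff (d - s) k =
  exp_coeff d k.+1.
Proof.
move=> d0; pose q : {poly R} := d%:P - 'X.
pose F : {poly R} := - ((k.+1`!%:R)^-1 *: q ^+ k.+1).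
have F'E s : F^`().[s] = exp_coeff (d - s) k.
  rewrite /F derivN derivZ deriv_exp /q derivB derivC derivX sub0r.
  rewrite !(hornerE, hornerMn)/= /exp_coeff/= factS natrM -(mulr_natr (_ * _)%R).
  have k0 : k.+1%:R != 0 :> R by rewrite pnatr_eq0.
  have f0 : k`!%:R != 0 :> R by rewrite pnatr_eq0 -lt0n fact_gt0.
  move: (k.+1%:R) (k`!%:R) k0 f0 => a b a0 b0.
  by field; rewrite a0 b0.
have FE s : F.[s] = - exp_coeff (d - s) k.+1.
  by rewrite /F /q !hornerE/= /exp_coeff/= mulrC.
rewrite (_ : (fun s => _) = horner F^`()); last first.
  by apply/funext => s; rewrite F'E.
rewrite /Rintegral (@continuous_FTC2 _ _ (horner F))//.
- by rewrite -EFinB/= !FE subrr subr0 /exp_coeff/= expr0n/= mul0r oppr0 add0r opprK.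
- exact/continuous_subspaceT/continuous_horner.
- split.
  + by move=> s _; exact: derivable_horner.
  + exact/cvg_at_right_filter/continuous_horner.
  + exact/cvg_at_left_filter/continuous_horner.
- by move=> s _; rewrite derivE.
Qed.

(** * Zonotopes and signals *)

Lemma zonotope_bounded (R : realType) (n p : nat) (G : 'M[R]_(n, p))
    (x : 'cV[R]_n) i :
  zonotope 0 G x -> `|x i 0| <= (\sum_j absmx (col j G)) i 0.
Proof.
move=> [a a1 <-]; rewrite add0r mxE summxE.
apply: le_trans (ler_norm_sum _ _ _) _; apply: ler_sum => j _.
by rewrite !mxE normrM ler_piMr// ler_norml a1.
Qed.

(** A diagonal zonotope is a box; where the half-width vanishes the division
    below yields the junk value zero, which is the right coefficient. *)
Lemma zonotope_diag (R : realType) (n : nat) (r w : 'cV[R]_n) :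
  (forall i, `|w i 0| <= r i 0) -> zonotope 0 (diag_mx r^T) w.
Proof.
move=> wr; exists (\col_i (w i 0 / r i 0)) => [i|].
  rewrite mxE -ler_norml normrM normfV.
  have r0 := le_trans (normr_ge0 _) (wr i).
  rewrite (ger0_norm r0); move: r0; rewrite le_eqVlt => /predU1P[<-|r0].
    by rewrite invr0 mulr0.
  by rewrite ler_pdivrMr// mul1r.
rewrite add0r; apply/colP => i; rewrite mul_diag_mx !mxE.
have := wr i; have [->|r0 _] := eqVneq (r i 0) 0.
  by rewrite normr_le0 mul0r => /eqP ->.
by rewrite mulrC divfK.
Qed.

(** The coefficient cube is compact, so some point of the zonotope is nearest to
    [y]; moving from it towards another point of the convex zonotope cannot
    decrease the distance, which is the variational inequality below. *)
Lemma zonotope_nearest (R : realType) (n p : nat) (G : 'M[R]_(n, p))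
    (y : 'cV[R]_n) :
  exists2 z, zonotope 0 G z &
    forall z', zonotope 0 G z' ->
      \sum_i (y - z) i 0 * (z' - z) i 0 <= 0.
Proof.
pose K : set 'rV[R]_p := [set a | forall j, `[-1, 1]%classic (a ord0 j)].
pose f (a : 'rV[R]_p) : R := \sum_i (y - G *m a^T) i 0 ^+ 2.
have cK : compact K.
  exact: (@rV_compact R _ (fun=> `[-1, 1]%classic) (fun=> @segment_compact _ _ _)).
have K0 : K !=set0.
  by exists 0 => j /=; rewrite mxE in_itv/=; apply/andP; split; lra.
have cf : continuous f.
  apply: continuous_big => [|i _]; first exact: add_continuous.
  move=> a.
  apply: (@continuous_comp _ _ _ (fun b => (y - G *m b^T) i 0) (fun x => x ^+ 2));
    last exact: exprn_continuous.
  rewrite [X in {for _, continuous X}](_ : _ =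
      fun b : 'rV[R]_p => y i 0 - \sum_j G i j * b ord0 j); last first.
    apply/funext => b; rewrite !mxE; congr (_ - _).
    by apply: eq_bigr => j _; rewrite mxE.
  apply: continuousB; first exact: cst_continuous.
  suff cs : continuous (fun b : 'rV[R]_p => \sum_j G i j * b ord0 j) by exact: cs.
  apply: continuous_big => [|j _]; first exact: add_continuous.
  by move=> b; apply: continuousM; [exact: cst_continuous|exact: coord_continuous].
have [a aK amin] := EVT_min_rV K0 cK (continuous_subspaceT cf).
have {}aK : K a by move: aK; rewrite inE.
exists (G *m a^T).
  exists a^T; last by rewrite add0r.
  by move=> j; rewrite mxE; have := aK j; rewrite /= in_itv.
move=> _ [b b1 <-]; rewrite add0r.
set q := \sum_i _; set N := \sum_i (G *m b - G *m a^T) i 0 ^+ 2.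
have N0 : 0 <= N by apply: sumr_ge0 => i _; exact: sqr_ge0.
rewrite leNgt; apply/negP => q0.
have qN : 0 < q + N by lra.
(* Moving by the fraction [l] of the way changes the squared distance by
   [- 2 l q + l ^ 2 N], negative for this [l] as soon as [q] is positive. *)
pose l := q / (q + N).
have l0 : 0 < l by rewrite divr_gt0.
have l1 : l <= 1 by rewrite ler_pdivrMr// mul1r lerDl.
have Kl : K (a + l *: (b^T - a)).
  move=> j /=; rewrite in_itv/= !mxE.
  have := aK j; rewrite /= in_itv/= => /andP[a1 a2].
  by have /andP[c1 c2] := b1 j; apply/andP; split; nra.
have := amin _ (mem_set Kl).
have -> : f (a + l *: (b^T - a)) = f a - l * q *+ 2 + l ^+ 2 * N.
  rewrite /f /q /N !mulr_sumr -sumrMnl -sumrB -big_split/=.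
  apply: eq_bigr => i _; rewrite linearD linearZ linearB/= trmxK.
  rewrite mulmxDr -scalemxAr mulmxBr; move: (G *m a^T) (G *m b) => u v.
  by rewrite !mxE; ring.
move=> h.
have {}h : q *+ 2 <= l * N.
  have : l * (q *+ 2) <= l * (l * N) by rewrite mulrA -expr2; lra.
  by rewrite ler_pM2l.
have : l * N <= q.
  rewrite /l mulrAC ler_pdivrMr//; nra.
by lra.
Qed.

(** If the mean were outside the zonotope, its nearest point would give a
    half-space containing the whole signal but not the mean. *)
Lemma zonotope_weighted_mean (R : realType) (n p : nat) (G : 'M[R]_(n, p))
    (D : set R) (w : R -> R) (u : R -> 'cV[R]_n) :
  measurable D -> (forall s, D s -> 0 <= w s) ->
  lebesgue_measure.-integrable D (EFin \o w) ->
  vintegrable D (fun s => w s *: u s) ->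
  0 < \int[lebesgue_measure]_(s in D) w s ->
  (forall s, zonotope 0 G (u s)) ->
  exists2 z, zonotope 0 G z &
    vintegral D (fun s => w s *: u s) =
    (\int[lebesgue_measure]_(s in D) w s) *: z.
Proof.
move=> mD w0 iw iwu; set c := Rintegral _ _ _ => c0 uG.
pose m : 'cV[R]_n := c^-1 *: vintegral D (fun s => w s *: u s).
have [z zG zmin] := zonotope_nearest G m; exists z => //.
suff mz : m = z by rewrite -mz scalerA divff ?scale1r ?gt_eqF.
have mE i : m i 0 = c^-1 * \int[lebesgue_measure]_(s in D) (w s * u s i 0).
  by rewrite 2!mxE; under eq_Rintegral do rewrite mxE.
pose v : 'cV[R]_n := m - z.
have iwu' i : lebesgue_measure.-integrable D (EFin \o (fun s => w s * u s i 0)).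
  have := iwu i; congr (_.-integrable _ (EFin \o _)).
  by apply/funext => s; rewrite mxE.
have : \int[lebesgue_measure]_(s in D) (\sum_i v i 0 * (w s * u s i 0)) <=
    \int[lebesgue_measure]_(s in D) ((\sum_i v i 0 * z i 0) * w s).
  apply: le_Rintegral => //.
  - by apply: integrable_sumR => // i; exact: integrable_mull.
  - exact: integrable_mull.
  move=> s Ds; have := zmin _ (uG s); rewrite -/v => h.
  rewrite -subr_le0 mulrC mulr_sumr -sumrB.
  rewrite (eq_bigr (fun i => w s * (v i 0 * (u s - z) i 0))); last first.
    by move=> i _; rewrite !mxE; ring.
  by rewrite -mulr_sumr mulr_ge0_le0// w0.
rewrite RintegralZl// Rintegral_sumR//; last by move=> i; exact: integrable_mull.
rewrite (eq_bigr (fun i => c * (v i 0 * m i 0))); last first.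
  by move=> i _; rewrite RintegralZl// mulrCA mE mulVKf// gt_eqF.
rewrite -mulr_sumr [leRHS]mulrC ler_pM2l// -subr_le0 -sumrB => h.
have /eqP : \sum_i v i 0 ^+ 2 = 0.
  apply/eqP; rewrite eq_le sumr_ge0 ?andbT => [|i _]; last exact: sqr_ge0.
  apply: le_trans h; apply: ler_sum => i _.
  by rewrite -mulrBr /v !mxE expr2.
rewrite psumr_eq0; last by move=> i _; exact: sqr_ge0.
move=> /allP v0.
apply/colP => i; have := v0 i (mem_index_enum i).
by rewrite sqrf_eq0 [v i 0]mxE [(- z) i 0]mxE subr_eq0 => /eqP.
Qed.

Lemma vintegrable_exp_tail (R : realType) (n p : nat) (A : 'M[R]_n)
    (G : 'M[R]_(n, p)) (d : R) (m : nat) (u : R -> 'cV[R]_n) :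
  input_signal (zonotope 0 G) u ->
  vintegrable `[0, d] (fun s => exp_tail A (d - s) m *m u s).
Proof.
move=> [mu uG].
apply: (@vintegrable_mulmx_bounded _ _ _ _ _ _ (exp_tail (absmx A) d m)
  (\sum_j absmx (col j G))) => //.
- by move=> i j; exact: measurable_exp_tail.
- move=> s i j /andP[s0 sd]; apply: exp_tail_le.
  by rewrite ger0_norm ?subr_ge0// lerBlDr lerDl.
- by move=> s i; exact: zonotope_bounded.
Qed.

Lemma norm_exp_coeff_le (R : realType) (d s : R) (k : nat) :
  0 <= s <= d -> `|exp_coeff (d - s) k| <= exp_coeff d k.
Proof.
move=> /andP[s0 sd]; have ds0 : 0 <= d - s by rewrite subr_ge0.
rewrite ger0_norm ?exp_coeff_ge0// /exp_coeff/= ler_wpM2r ?invr_ge0//.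
by apply: lerXn2r; rewrite ?nnegrE ?(le_trans s0 sd)// lerBlDr lerDl.
Qed.

Lemma measurable_exp_coeff (R : realType) (d : R) (k : nat) :
  measurable_fun [set: R] (fun s => exp_coeff (d - s) k).
Proof.
by apply: measurable_funM => //; apply: measurable_funX; exact: measurable_funB.
Qed.

Lemma integrable_exp_coeff (R : realType) (d : R) (k : nat) :
  lebesgue_measure.-integrable `[0, d] (EFin \o (fun s => exp_coeff (d - s) k)).
Proof.
apply: (@integrable_bounded _ _ _ (exp_coeff d k)).
  exact: measurable_exp_coeff.
by move=> s; exact: norm_exp_coeff_le.
Qed.

Lemma vintegrable_exp_coeff (R : realType) (n p : nat) (G : 'M[R]_(n, p))
    (d : R) (k : nat) (u : R -> 'cV[R]_n) :
  input_signal (zonotope 0 G) u ->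
  vintegrable `[0, d] (fun s => exp_coeff (d - s) k *: u s).
Proof.
move=> [mu uG] i.
apply: (@integrable_bounded _ _ _ (exp_coeff d k * (\sum_j absmx (col j G)) i 0)).
  under eq_fun do rewrite mxE.
  by apply: measurable_funM => //; exact: measurable_exp_coeff.
move=> s s0d; rewrite mxE normrM.
by apply: ler_pM => //; [exact: norm_exp_coeff_le|exact: zonotope_bounded].
Qed.

(** * One time step *)

(** Each order contributes a scalar-weighted integral of the signal, to which
    [zonotope_weighted_mean] applies; only the remainder mixes weight and
    matrix. *)
Lemma vintegral_expmx (R : realType) (n p : nat) (A : 'M[R]_n)
    (G : 'M[R]_(n, p)) (d : R) (m : nat) (u : R -> 'cV[R]_n) :
  input_signal (zonotope 0 G) u ->
  vintegral `[0, d] (fun s => expmx ((d - s) *: A) *m u s) =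
  \sum_(0 <= k < m)
    A ^+ k *m vintegral `[0, d] (fun s => exp_coeff (d - s) k *: u s) +
  vintegral `[0, d] (fun s => exp_tail A (d - s) m *m u s).
Proof.
move=> uG.
have intu k : vintegrable `[0, d] (fun s => A ^+ k *m (exp_coeff (d - s) k *: u s)).
  by apply: vintegrable_mulmx => //; exact: vintegrable_exp_coeff uG.
rewrite (@eq_vintegral _ _ _ _ (fun s =>
    \sum_(0 <= k < m) A ^+ k *m (exp_coeff (d - s) k *: u s) +
    exp_tail A (d - s) m *m u s)); last first.
  move=> s _; rewrite -[in LHS](subrK (\sum_(0 <= k < m) exp_coeff (d - s) k *: A ^+ k)
    (expmx ((d - s) *: A))) mulmxDl addrC; congr (_ + _).
  by rewrite mulmx_suml; apply: eq_bigr => k _; rewrite -scalemxAl -scalemxAr.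
rewrite vintegralD//; last 2 first.
- exact: vintegrable_sum.
- exact: vintegrable_exp_tail uG.
congr (_ + _); rewrite vintegral_sum//; apply: eq_bigr => k _.
by rewrite vintegral_mulmx//; exact: vintegrable_exp_coeff uG.
Qed.

(** The bound is uniform over the step because [exp_remainder] grows with the
    time. *)
Lemma remainder_set_vintegral (R : realType) (n p : nat) (A : 'M[R]_n)
    (G : 'M[R]_(n, p)) (d : R) (eta : nat) (u : R -> 'cV[R]_n) :
  0 <= d -> input_signal (zonotope 0 G) u ->
  remainder_set A G d eta
    (vintegral `[0, d] (fun s => exp_tail A (d - s) eta.+1 *m u s)).
Proof.
move=> d0 [mu uG]; apply: zonotope_diag => i; rewrite [in leLHS]mxE.
have -> : (d *: exp_remainder A d eta *m
      (absmx (0 : 'cV[R]_n) + \sum_j absmx (col j G))) i 0 =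
    (d - 0) * (exp_tail (absmx A) d eta.+1 *m \sum_j absmx (col j G)) i 0.
  rewrite exp_remainderE -scalemxAl mxE subr0.
  rewrite (_ : absmx 0 = 0) ?add0r//.
  by apply/colP => j; rewrite !mxE normr0.
apply: normr_Rintegral_le => //.
  under eq_fun do rewrite mxE.
  by apply: measurable_sum => j; apply: measurable_funM => //; exact: measurable_exp_tail.
move=> s /andP[s0 sd]; rewrite !mxE; apply: le_trans (ler_norm_sum _ _ _) _.
apply: ler_sum => j _; rewrite normrM ler_pM//; last exact: zonotope_bounded.
by apply: exp_tail_le; rewrite ger0_norm ?subr_ge0// lerBlDr lerDl.
Qed.

Lemma big_minkowski_sum (R : realType) (n : nat) (I : Type) (r : seq I)
    (S : I -> set 'cV[R]_n) (f : I -> 'cV[R]_n) :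
  (forall i, S i (f i)) ->
  (\big[@minkowski_sum R n/[set 0]]_(i <- r) S i) (\sum_(i <- r) f i).
Proof.
move=> Sf; elim: r => [|i r IH]; first by rewrite !big_nil.
by rewrite !big_cons; exists (f i) => //; exists (\sum_(j <- r) f j).
Qed.

Lemma mulmx_exp_coeff (R : realType) (n : nat) (A : 'M[R]_n) (d : R) (k : nat)
    (z : 'cV[R]_n) :
  A ^+ k *m (exp_coeff d k.+1 *: z) = Atilde A d k *m z.
Proof. by rewrite -scalemxAr scalemxAl. Qed.

(** Each weighted mean of the signal is a multiple of a point of the zonotope;
    the points for different orders are unrelated, which is why the outer
    approximation is a Minkowski sum over the orders. *)
Lemma particular_solution_sub_step (R : realType) (n p : nat) (A : 'M[R]_n)
    (G : 'M[R]_(n, p)) (d : R) (eta : nat) :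
  0 < d ->
  particular_solution A (zonotope 0 G) d `<=` particular_step A G d eta.
Proof.
move=> d0 _ [u uG <-].
rewrite -[X in particular_step _ _ _ _ X]/(vintegral _ _).
have /choice[z zP] k : exists z, zonotope 0 G z /\
    vintegral `[0, d] (fun s => exp_coeff (d - s) k *: u s) =
    exp_coeff d k.+1 *: z.
  have [mu uZ] := uG.
  have [] := @zonotope_weighted_mean _ _ _ G `[0, d] (fun s => exp_coeff (d - s) k) u.
  - by [].
  - by move=> s /=; rewrite in_itv/= => /andP[_ sd]; rewrite exp_coeff_ge0// subr_ge0.
  - exact: integrable_exp_coeff.
  - exact: vintegrable_exp_coeff uG.
  - by rewrite Rintegral_exp_coeff// /exp_coeff/= divr_gt0 ?exprn_gt0// ltr0n fact_gt0.
  - exact: uZ.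
  by move=> z zG ->; exists z; rewrite Rintegral_exp_coeff.
rewrite (vintegral_expmx A d eta.+1 uG).
exists (\sum_(0 <= k < eta.+1)
    A ^+ k *m vintegral `[0, d] (fun s => exp_coeff (d - s) k *: u s)).
  apply: big_minkowski_sum => k; have [zG ->] := zP k.
  by rewrite mulmx_exp_coeff; exists (z k).
exists (vintegral `[0, d] (fun s => exp_tail A (d - s) eta.+1 *m u s)) => //.
by apply: remainder_set_vintegral => //; exact: ltW.
Qed.

Lemma input_signal_cst (R : realType) (n : nat) (U : set 'cV[R]_n)
    (v : 'cV[R]_n) :
  U v -> input_signal U (fun=> v).
Proof. by move=> Uv; split => // i; exact: measurable_cst. Qed.

(** A point of the outer approximation is compared with the response to the
    constant signal given by its own zonotope point of order zero: the two agree
    in that order, and all the rest is bounded by the radii of the boxes. *)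
Lemma particular_step_near (R : realType) (n p : nat) (A S : 'M[R]_n)
    (G : 'M[R]_(n, p)) (d : R) (eta : nat) (y : 'cV[R]_n) :
  0 < d -> particular_step A G d eta y ->
  exists2 x, particular_solution A (zonotope 0 G) d x &
    ((enorm (S *m (x - y)))%:E <=
     err (linear_map S (minkowski_sum
        (linear_map (\sum_(1 <= i < eta.+1) Atilde A d i) (zonotope 0 G))
        (remainder_set A G d eta))) +
     err (linear_map S (minkowski_sum
        (\big[@minkowski_sum R n/[set 0%R]]_(1 <= i < eta.+1)
           linear_map (Atilde A d i) (zonotope 0 G))
        (remainder_set A G d eta))))%E.
Proof.
move=> d0 [y01 y01P [e eP <-]]; move: y01P; rewrite big_ltn//.
move=> [_ [v vG <-] [y1 y1P <-]].
have uG := input_signal_cst vG.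
exists (vintegral `[0, d] (fun s => expmx ((d - s) *: A) *m v)).
  by exists (fun=> v).
rewrite (vintegral_expmx A d eta.+1 uG).
set e' := vintegral _ (fun s => exp_tail _ _ _ *m _).
have -> : \sum_(0 <= k < eta.+1)
      A ^+ k *m vintegral `[0, d] (fun s => exp_coeff (d - s) k *: v) =
    Atilde A d 0 *m v + (\sum_(1 <= k < eta.+1) Atilde A d k) *m v.
  rewrite -mulmxDl -big_ltn// mulmx_suml; apply: eq_bigr => k _.
  rewrite -mulmx_exp_coeff; congr (_ *m _); apply/colP => i; rewrite !mxE.
  under eq_Rintegral do rewrite mxE.
  by rewrite RintegralZr ?Rintegral_exp_coeff//; exact: integrable_exp_coeff.
have cancel_head (a b c a' c' : 'cV[R]_n) :
    a + b + c - (a + a' + c') = (b + c) - (a' + c').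
  by apply/colP => i; rewrite !mxE; ring.
rewrite cancel_head mulmxBr; apply: enormB_le_err.
  eexists; last reflexivity.
  eexists; first by exists v.
  by exists e' => //; apply: remainder_set_vintegral => //; exact: ltW.
by eexists; last reflexivity; exists y1 => //; exists e.
Qed.

(** * Concatenation of signals *)

(** The two measures agree on half-open intervals, which determine the Lebesgue
    measure. *)
Lemma lebesgue_measure_shift (R : realType) (a : R) (B : set R) :
  measurable B ->
  pushforward lebesgue_measure ((fun s : R => s + a) : R -> measurableTypeR R) B =
  lebesgue_measure B.
Proof.
move=> mB; apply/esym/lebesgue_measure_unique => //=.
  exact: measurable_funD.
move=> _ _ [[b c]] _ <-.
rewrite /pushforward (_ : _ @^-1` _ = `]b - a, c - a]%classic); last first.
  by apply/seteqP; split => s /=; rewrite !in_itv/= ltrBlDr lerBrDr.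
rewrite !lebesgue_measure_itv/= !lte_fin ltrD2r; case: ifPn => // _.
by rewrite -!EFinD; congr EFin; ring.
Qed.

Lemma Rintegral_shift (R : realType) (a : R) (D : set R) (f : R -> R) :
  measurable D -> measurable_fun [set: R] f ->
  lebesgue_measure.-integrable ((fun s => s + a) @^-1` D)
    (EFin \o (fun s => f (s + a))) ->
  \int[lebesgue_measure]_(s in D) f s =
  \int[lebesgue_measure]_(s in (fun s => s + a) @^-1` D) f (s + a).
Proof.
move=> mD mf intf; rewrite /Rintegral; congr fine.
have ms : measurable_fun [set: measurableTypeR R]
    ((fun s : R => s + a) : measurableTypeR R -> measurableTypeR R).
  exact: measurable_funD.
have := @integral_pushforward _ _ _ (measurableTypeR R) R _ ms lebesgue_measure
  D (EFin \o f).
move=> /= <-//; last exact/measurable_EFinP.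
by apply: eq_measure_integral => B mB _; apply/esym; exact: lebesgue_measure_shift.
Qed.

Lemma measurable_response (R : realType) (n : nat) (A : 'M[R]_n) (d : R)
    (U : set 'cV[R]_n) (u : R -> 'cV[R]_n) i :
  input_signal U u ->
  measurable_fun [set: R] (fun s => (expmx ((d - s) *: A) *m u s) i 0).
Proof.
move=> [mu _]; rewrite [X in measurable_fun _ X](_ : _ =
    fun s => \sum_j exp_tail A (d - s) 0%N i j * u s j 0); last first.
  by apply/funext => s; rewrite exp_tail0 mxE.
by apply: measurable_sum => j; apply: measurable_funM => //; exact: measurable_exp_tail.
Qed.

Lemma vintegrable_response (R : realType) (n p : nat) (A : 'M[R]_n)
    (G : 'M[R]_(n, p)) (d : R) (u : R -> 'cV[R]_n) :
  input_signal (zonotope 0 G) u ->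
  vintegrable `[0, d] (fun s => expmx ((d - s) *: A) *m u s).
Proof.
move=> uG; have := @vintegrable_exp_tail _ _ _ A _ d 0%N _ uG.
by congr (vintegrable _ _); apply/funext => s; rewrite exp_tail0.
Qed.

Lemma input_signal_shift (R : realType) (n : nat) (U : set 'cV[R]_n)
    (u : R -> 'cV[R]_n) (b : R) :
  input_signal U u -> input_signal U (fun s => u (s + b)).
Proof.
move=> [mu uU]; split => // i.
apply: (measurableT_comp (f := fun s => u s i 0)) => //.
exact: measurable_funD.
Qed.

Lemma input_signal_concat (R : realType) (n : nat) (U : set 'cV[R]_n)
    (u v : R -> 'cV[R]_n) (b : R) :
  input_signal U u -> input_signal U v ->
  input_signal U (fun s => if s < b then v s else u (s - b)).
Proof.
move=> uU vU; have [mu' uU'] := input_signal_shift (- b) uU.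
have [mv vU'] := vU; split => [i|s]; last by case: ifP.
rewrite [X in measurable_fun _ X](_ : _ =
    fun s => if s < b then v s i 0 else u (s - b) i 0); last first.
  by apply/funext => s; case: ifP.
apply: measurable_fun_ifT => //.
exact: measurable_fun_ltr.
Qed.

(** The integral is cut at time [b].  Before [b] the factor [expmx (a *: A)] comes
    out of the integral by [expmxD]; after [b] the time is translated. *)
Lemma response_concat (R : realType) (n p : nat) (A : 'M[R]_n)
    (G : 'M[R]_(n, p)) (a b : R) (u : R -> 'cV[R]_n) :
  0 <= a -> 0 <= b -> input_signal (zonotope 0 G) u ->
  vintegral `[0, a + b] (fun s => expmx ((a + b - s) *: A) *m u s) =
  vintegral `[0, a] (fun s => expmx ((a - s) *: A) *m u (s + b)) +
  expmx (a *: A) *m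
    vintegral `[0, b] (fun s => expmx ((b - s) *: A) *m u s).
Proof.
move=> a0 b0 uG; have int1 := vintegrable_response A (a + b) uG.
have int2 := vintegrable_response A b uG.
have int3 := vintegrable_response A a (input_signal_shift b uG).
rewrite -vintegral_mulmx//.
rewrite [X in _ = _ + X](@eq_vintegral _ _ _ _
    (fun s => expmx ((a + b - s) *: A) *m u s)); last first.
  by move=> s _; rewrite mulmxA -expmxD addrA.
apply/colP => i; rewrite 4!mxE; apply/eqP; rewrite -subr_eq; apply/eqP.
rewrite (Rintegral_itvB (int1 i)); [|by rewrite bnd_simp|by rewrite bnd_simp lerDr].
rewrite Rintegral_itv_obnd_cbnd; last first.
  by apply: integrableS (int1 i) => //; apply: subset_itvr; rewrite bnd_simp.
have shiftE : (fun s => s + b) @^-1` `[b, a + b]%classic = `[0, a]%classic.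
  by apply/seteqP; split => s /=; rewrite !in_itv/= lerD2r lerDr.
have abE s : a + b - (s + b) = a - s by ring.
rewrite (Rintegral_shift (a := b)).
- by rewrite shiftE; apply: eq_Rintegral => s _; rewrite abE.
- exact: measurable_itv.
- exact: measurable_response uG.
- rewrite shiftE; have := int3 i; congr (_.-integrable _ (EFin \o _)).
  by apply/funext => s; rewrite abE.
Qed.

Lemma vintegral_itv_bndo (R : realType) (n : nat) (a b : R)
    (f : R -> 'cV[R]_n) :
  vintegrable `[a, b] f -> vintegral `[a, b[ f = vintegral `[a, b] f.
Proof.
move=> intf; apply/colP => i; rewrite !mxE Rintegral_itv_bndo_bndc//.
by apply: integrableS (intf i) => //; apply: subset_itvl; rewrite bnd_simp.
Qed.

Lemma particular_solutionD (R : realType) (n p : nat) (A : 'M[R]_n)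
    (G : 'M[R]_(n, p)) (a b : R) :
  0 <= a -> 0 <= b ->
  particular_solution A (zonotope 0 G) (a + b) =
  minkowski_sum (particular_solution A (zonotope 0 G) a)
    (linear_map (expmx (a *: A)) (particular_solution A (zonotope 0 G) b)).
Proof.
move=> a0 b0; apply/seteqP; split => [_ [u uG <-]|].
  have := response_concat A a0 b0 uG; rewrite {1}/vintegral => ->.
  eexists; first by exists (fun s => u (s + b)); [exact: input_signal_shift|].
  eexists; last reflexivity.
  by eexists; last reflexivity; exists u.
move=> _ [_ [u uG <-] [_ [_ [v vG <-] <-] <-]].
pose w s := if s < b then v s else u (s - b).
have wG : input_signal (zonotope 0 G) w by exact: input_signal_concat.
have wu : vintegral `[0, a] (fun s => expmx ((a - s) *: A) *m w (s + b)) =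
    vintegral `[0, a] (fun s => expmx ((a - s) *: A) *m u s).
  apply: eq_vintegral => s /=; rewrite in_itv/= => /andP[s0 _].
  by rewrite /w ltNge lerDr s0/= addrK.
(* At the junction [w] takes the value of [u], not of [v]; the two responses up
   to time [b] are therefore compared on the half-open interval. *)
have wv : vintegral `[0, b] (fun s => expmx ((b - s) *: A) *m w s) =
    vintegral `[0, b] (fun s => expmx ((b - s) *: A) *m v s).
  rewrite -vintegral_itv_bndo; last exact: vintegrable_response wG.
  rewrite -[RHS]vintegral_itv_bndo; last exact: vintegrable_response vG.
  apply: eq_vintegral => s /=; rewrite in_itv/= => /andP[_ sb].
  by rewrite /w sb.
exists w => //; have := response_concat A a0 b0 wG.
by rewrite wu wv; apply.
Qed.

Lemma particular_solution0 (R : realType) (n p : nat) (A : 'M[R]_n)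
    (G : 'M[R]_(n, p)) :
  particular_solution A (zonotope 0 G) 0 = [set 0].
Proof.
have resp0 (u : R -> 'cV[R]_n) :
    \col_i \int[lebesgue_measure]_(s in `[0, 0]) (expmx ((0 - s) *: A) *m u s) i 0
    = 0.
  by apply/colP => i; rewrite !mxE set_itv1 Rintegral_set1.
apply/seteqP; split => [_ [u _ <-]|_ ->] /=; first exact: resp0.
exists (fun=> 0); last exact: resp0.
apply: input_signal_cst; exists 0 => [i|]; last by rewrite mulmx0 addr0.
by rewrite mxE lerN10 ler01.
Qed.

(** * Accumulation over the steps *)

Lemma particular_solution_sub_approx (R : realType) (n p : nat) (A : 'M[R]_n)
    (G : 'M[R]_(n, p)) (t : nat -> R) (eta : nat -> nat) (k : nat) :
  t 0%N = 0 -> (forall l, t l < t l.+1) ->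
  particular_solution A (zonotope 0 G) (t k) `<=` particular_approx A G t eta k.
Proof.
move=> t0 tS; have tge0 l : 0 <= t l.
  by elim: l => [|l IH]; [rewrite t0|exact: le_trans IH (ltW (tS l))].
elim: k => [|k IH]; first by rewrite t0 particular_solution0.
have dt0 : 0 < t k.+1 - t k by rewrite subr_gt0.
rewrite -[in X in X `<=` _](subrKC (t k) (t k.+1)) particular_solutionD ?(ltW dt0)//.
move=> _ [x /IH xP [_ [y yP <-] <-]]; exists x => //.
eexists; last reflexivity.
by exists y => //; exact: particular_solution_sub_step.
Qed.

Lemma particular_approx_near (R : realType) (n p : nat) (A : 'M[R]_n)
    (G : 'M[R]_(n, p)) (t : nat -> R) (eta : nat -> nat) (k : nat)
    (y : 'cV[R]_n) :
  t 0%N = 0 -> (forall l, t l < t l.+1) ->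
  particular_approx A G t eta k y ->
  exists2 x, particular_solution A (zonotope 0 G) (t k) x &
    ((enorm (x - y))%:E <= error_bound A G t eta k)%E.
Proof.
move=> t0 tS; have tge0 l : 0 <= t l.
  by elim: l => [|l IH]; [rewrite t0|exact: le_trans IH (ltW (tS l))].
elim: k y => [|k IH] y /=.
  by move=> ->; exists 0; rewrite ?subrr ?enorm0// t0 particular_solution0.
have dt0 : 0 < t k.+1 - t k by rewrite subr_gt0.
move=> [y1 /IH[x1 x1P xy1] [_ [y2 y2P <-] <-]].
have [x2 x2P xy2] := particular_step_near (expmx (t k *: A)) dt0 y2P.
exists (x1 + expmx (t k *: A) *m x2).
  rewrite -(subrKC (t k) (t k.+1)) particular_solutionD ?(ltW dt0)//.
  by exists x1 => //; eexists; last reflexivity; exists x2.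
rewrite opprD addrACA -mulmxBr.
apply: le_trans (leeD xy1 xy2); rewrite -EFinD lee_fin.
exact: enormD.
Qed.

Lemma error_bound_ge0 (R : realType) (n p : nat) (A : 'M[R]_n)
    (G : 'M[R]_(n, p)) (t : nat -> R) (eta : nat -> nat) (k : nat) :
  (0 <= error_bound A G t eta k)%E.
Proof. by elim: k => //= k IH; rewrite !adde_ge0// err_ge0. Qed.

Theorem proposition2 (R : realType) (n p : nat) (A : 'M[R]_n)
    (G0 : 'M[R]_(n, p)) (t : nat -> R) (eta : nat -> nat)
    (t0 : t 0%N = 0) (t_incr : forall k, t k < t k.+1)
    (eta_gt0 : forall k, (0 < eta k)%N) (k : nat) :
  (hausdorff_dist
     (linear_map (expmx (t k *: A))
        (particular_solution A (zonotope 0 G0) (t k.+1 - t k)))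
     (linear_map (expmx (t k *: A))
        (particular_step A G0 (t k.+1 - t k) (eta k)))
   <= step_error_bound A G0 (t k) (t k.+1 - t k) (eta k))%E
  /\
  (hausdorff_dist
     (particular_solution A (zonotope 0 G0) (t k.+1))
     (particular_approx A G0 t eta k.+1)
   <= error_bound A G0 t eta k.+1)%E.
Proof.
have dt0 : 0 < t k.+1 - t k by rewrite subr_gt0.
split; apply: hausdorff_dist_le.
- move=> _ [x xP <-]; exists (expmx (t k *: A) *m x).
    by exists x => //; exact: particular_solution_sub_step.
  by rewrite subrr enorm0 adde_ge0// err_ge0.
- move=> _ [y yP <-].
  have [x xP xy] := particular_step_near (expmx (t k *: A)) dt0 yP.
  by exists (expmx (t k *: A) *m x); [exists x|rewrite -mulmxBr].
- move=> x xP; exists x; first exact: particular_solution_sub_approx xP.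
  by rewrite subrr enorm0 error_bound_ge0.
- by move=> y yP; exact: particular_approx_near yP.
Qed.
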